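(* Let $G$ be a finite graph and let $e$ and $f$ be distinct edges of $G$. In the acyclic subgraph toggle group $T(\mathcal{AS}(G))$, $(t_et_f)^2=1$ if and only if no cycle of $G$ contains both $e$ and $f$.
   Context: An acyclic subgraph of a graph $G$ is a collection of edges in $E(G)$ in which there is no cycle; $\mathcal{AS}(G)\subseteq 2^{E(G)}$ is the set of acyclic subgraphs, with ground set the edge set $E(G)$. For $e\in E(G)$ the toggle $t_e:\mathcal{AS}(G)\to\mathcal{AS}(G)$ is given by $t_e(X)=X\cup\{e\}$ if $e\notin X$ and $X\cup\{e\}\in\mathcal{AS}(G)$; $t_e(X)=X\setminus\{e\}$ if $e\in X$ and $X\setminus\{e\}\in\mathcal{AS}(G)$; and $t_e(X)=X$ otherwise. $T(\mathcal{AS}(G))$ is the subgroup of the symmetric group on $\mathcal{AS}(G)$ generated by all $t_e$, $e\in E(G)$. *)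

(* Defs.v *)
From HB Require Import structures.
From mathcomp Require Import all_boot all_fingroup.

Set Implicit Arguments.
Unset Strict Implicit.
Unset Printing Implicit Defensive.

Local Open Scope group_scope.

(* Finite graphs with an explicit edge set. Parallel edges and loops are
   allowed (a loop has a single end); a simple graph is one where [ends] is
   injective and all [ends x] have exactly two elements. *)
Record multigraph := Multigraph {
  vertex : finType;
  edge : finType;
  ends : edge -> {set vertex};
  ends_card : forall x, 0 < #|ends x| <= 2
}.

Section Cycles.

Variable G : multigraph.
Implicit Types (vs : seq (vertex G)) (es : seq (edge G)).
Implicit Types (C X : {set edge G}).

(* vs = v_0, ..., v_(k-1) and es = e_0, ..., e_(k-1) with k > 0, the v_i
   distinct, the e_i distinct, and e_i joining v_i to v_(i+1 mod k). Thus a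
   loop is a cycle (k = 1), as are two distinct parallel edges (k = 2), but an
   edge traversed back and forth is not. *)
Definition traces_cycle vs es : bool :=
  [&& es != [::], uniq vs, uniq es &
      [seq ends x | x <- es] == [seq [set p.1; p.2] | p <- zip vs (rot 1 vs)]].

(* Bounding both lengths by #|C| makes the predicate boolean without loss of
   generality: see [is_cycleP]. *)
Definition is_cycle C : bool :=
  [exists vs : #|C|.-tuple (vertex G), exists es : #|C|.-tuple (edge G),
     traces_cycle vs es && (C == [set x in es])].

Lemma is_cycleP C :
  reflect (exists vs es, traces_cycle vs es /\ C = [set x in es]) (is_cycle C).
Proof.
apply: (iffP existsP) => [[vs /existsP[es /andP[h /eqP hC]]]|[vs [es [h hC]]]].
  by exists vs, es.
have szes : size es == #|C|.
  by case/and4P: h => _ _ ues _; rewrite hC cardsE (card_uniqP ues).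
have szvs : size vs == #|C|.
  case/and4P: h => _ _ _ /eqP/(congr1 size).
  by rewrite !size_map size_zip size_rot minnn -(eqP szes) => ->.
exists (Tuple szvs); apply/existsP; exists (Tuple szes); rewrite h /=.
by apply/eqP.
Qed.

Definition acyclic X : bool :=
  [forall C : {set edge G}, is_cycle C ==> ~~ (C \subset X)].

Definition acyclic_subgraphs : {set {set edge G}} := [set X | acyclic X].

End Cycles.

Section Toggles.

Variables (E : finType) (L : {set {set E}}).

Definition toggle_set (e : E) (X : {set E}) : {set E} :=
  if (e \notin X) && (e |: X \in L) then e |: X
  else if (e \in X) && (X :\ e \in L) then X :\ e
  else X.

Lemma toggle_set_in e X : X \in L -> toggle_set e X \in L.
Proof.
by rewrite /toggle_set; case: ifP => [/andP[]|_] //; case: ifP => [/andP[]|].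
Qed.

Definition toggle_fun (e : E) (X : {X | X \in L}) : {X | X \in L} :=
  exist _ (toggle_set e (val X)) (toggle_set_in e (valP X)).

Lemma toggle_funK e : involutive (toggle_fun e).
Proof.
case=> X XL; apply: val_inj => /=; rewrite [toggle_set e X]/toggle_set.
have [eX|eX] := boolP (e \in X) => /=; case: ifP => XeL; rewrite /toggle_set.
- by rewrite setD11 /= setD1K // XL.
- by rewrite eX /= XeL.
- by rewrite setU11 /= setU1K // XL.
- by rewrite (negPf eX) /= XeL.
Qed.

Definition toggle_perm (e : E) : {perm {X | X \in L}} :=
  perm (can_inj (toggle_funK e)).

Definition toggle_group : {group {perm {X | X \in L}}} :=
  <<[set toggle_perm e | e : E]>>%G.

Lemma toggle_perm_in e : toggle_perm e \in toggle_group.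
Proof. by apply: mem_gen; apply: imset_f. Qed.

Definition toggle (e : E) : [subg toggle_group] := Subg (toggle_perm_in e).

End Toggles.

(* Main.v *)
(* The nontrivial graph-theoretic input is that cycles form an antichain.
   Suppose C is a cycle contained in the cycle D, and y is an edge of C. At the
   vertex where y meets its successor y' along D, the cycle C must continue
   along another edge of D, and y' is the only one available; so C is closed
   under successors along D, whence C = D. Thus if e and f lie on a common
   cycle C, the sets C - {e, f}, C - {e} and C - {f} are acyclic while C is not,
   and (t_e t_f)^2 moves C - {e, f}. Otherwise X + e + f is acyclic whenever
   X + e and X + f are, and then t_e and t_f commute. *)

Require Import Defs.
From mathcomp Require Import all_boot all_fingroup.

Set Implicit Arguments.
Unset Strict Implicit.
Unset Printing Implicit Defensive.

Local Open Scope group_scope.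

Section HereditaryToggles.

Variables (E : finType) (L : {set {set E}}).
Hypothesis L_sub : forall X Y : {set E}, X \subset Y -> Y \in L -> X \in L.

Lemma toggle_setE (e : E) (X : {set E}) : X \in L ->
  toggle_set L e X =
    if e \in X then X :\ e else if e |: X \in L then e |: X else X.
Proof.
move=> XL; rewrite /toggle_set; case: (boolP (e \in X)) => eX //=.
by rewrite (L_sub _ XL) ?subD1set.
Qed.

(** By heredity a removal always succeeds, so two toggles can only interfere when adding one element
    is blocked by the presence of the other; the exchange hypothesis excludes this. *)
Lemma toggle_setC (e f : E) (X : {set E}) : e != f ->
    (forall Y : {set E}, e \notin Y -> f \notin Y ->
       e |: Y \in L -> f |: Y \in L -> e |: (f |: Y) \in L) ->
  X \in L ->
  toggle_set L e (toggle_set L f X) = toggle_set L f (toggle_set L e X).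
Proof.
move=> + + XL.
(* Stated for a generic pair, since it serves both cases where [X] contains exactly one of [e] and
   [f]. *)
have mixed (a b : E) : a != b -> a \in X -> b \notin X ->
    (forall Y : {set E}, a \notin Y -> b \notin Y ->
       a |: Y \in L -> b |: Y \in L -> a |: (b |: Y) \in L) ->
    toggle_set L a (toggle_set L b X) = toggle_set L b (toggle_set L a X).
  move=> ab aX bX H.
  have XaL : X :\ a \in L by apply: L_sub XL; exact: subD1set.
  rewrite (toggle_setE b XL) (toggle_setE a XL) (negPf bX) aX.
  rewrite (toggle_setE b XaL) !inE (negPf bX) andbF.
  have bXa : b |: X :\ a = (b |: X) :\ a.
    apply/setP=> z; rewrite !inE; case: eqVneq => // ->.
    by rewrite eq_sym (negPf ab).
  (* Whether [b] can be added does not depend on the presence of [a]: exchange at [X :\ a] gives one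
     direction, heredity the other. *)
  have -> : (b |: X :\ a \in L) = (b |: X \in L).
    apply/idP/idP => [bL|]; last by apply: L_sub; rewrite bXa subD1set.
    have -> : b |: X = a |: (b |: X :\ a) by rewrite bXa setD1K // !inE aX orbT.
    by apply: H; rewrite ?setD11 ?setD1K // !inE (negPf bX) andbF.
  by case: ifP => bL; rewrite toggle_setE ?inE ?aX ?orbT.
move=> ef H.
have [eX|eX] := boolP (e \in X); have [fX|fX] := boolP (f \in X).
- have XeL : X :\ e \in L by apply: L_sub XL; exact: subD1set.
  have XfL : X :\ f \in L by apply: L_sub XL; exact: subD1set.
  rewrite (toggle_setE e XL) (toggle_setE f XL) eX fX !toggle_setE // !inE.
  by rewrite eX fX ef eq_sym ef /= setDDl setUC -setDDl.
- exact: mixed.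
- symmetry; apply: mixed; rewrite 1?eq_sym // => Y fY eY fL eL.
  by rewrite setUCA; exact: H.
- rewrite (toggle_setE e XL) (toggle_setE f XL) (negPf eX) (negPf fX).
  have efL : e |: (f |: X) \in L -> e |: X \in L /\ f |: X \in L.
    by move=> efL; split; apply: L_sub efL; rewrite ?setUS ?subsetUr.
  have fe : (f == e) = false by rewrite eq_sym; exact: negPf.
  have [eL|eL] := boolP (e |: X \in L); have [fL|fL] := boolP (f |: X \in L).
  + rewrite !toggle_setE // !inE (negPf eX) (negPf fX) (negPf ef) fe /=.
    by rewrite [f |: (e |: X)]setUCA H.
  + rewrite !toggle_setE // !inE (negPf eX) (negPf fX) fe eL /=.
    by rewrite setUCA; case: ifP => // /efL[_]; rewrite (negPf fL).
  + rewrite !toggle_setE // !inE (negPf eX) (negPf fX) (negPf ef) fL /=.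
    by case: ifP => // /efL[]; rewrite (negPf eL).
  + by rewrite !toggle_setE // (negPf eX) (negPf fX) (negPf eL) (negPf fL).
Qed.

(** A product of permutations applies its left factor first, hence [e] is toggled innermost. *)
Lemma sqr_toggleM_eq1_set e f :
  (toggle L e * toggle L f) ^+ 2 = 1 <->
  forall X, X \in L -> toggle_set L f (toggle_set L e
                         (toggle_set L f (toggle_set L e X))) = X.
Proof.
rewrite expgS expg1; split=> [h X XL | h].
  move/(congr1 (fun g : [subg toggle_group L] =>
    val ((val g : {perm {Y | Y \in L}}) (exist _ X XL)))): h.
  by do !rewrite /= permE.
apply/val_inj/permP=> -[X XL]; apply: val_inj.
by do !rewrite /= permE; exact: h.
Qed.

(** Toggles are involutions, so the square is trivial exactly when they commute. *)
Lemma sqr_toggleM_eq1 (e f : E) : e != f ->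
  (toggle L e * toggle L f) ^+ 2 = 1 <->
  (forall X : {set E}, e \notin X -> f \notin X ->
     e |: X \in L -> f |: X \in L -> e |: (f |: X) \in L).
Proof.
move=> ef; apply: (iff_trans (sqr_toggleM_eq1_set e f)).
split=> [h X eX fX eL fL | h X XL]; last first.
  have K a Y : Y \in L -> toggle_set L a (toggle_set L a Y) = Y.
    by move=> YL; have /(congr1 val) := toggle_funK a (exist _ Y YL).
  by rewrite -(toggle_setC ef h) ?toggle_set_in // K ?toggle_set_in // K.
have XL : X \in L by apply: L_sub eL; exact: subsetUr.
(* If exchange fails at [X], the four toggles run through [X + e], [X + e] (adding [f] is blocked),
   [X], [X + f], and so do not return to [X]. *)
apply: contraT => efL; have := h X XL.
rewrite (toggle_setE e XL) (negPf eX) eL (toggle_setE f eL) !inE.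
rewrite eq_sym (negPf ef) (negPf fX) /= setUCA (negPf efL).
rewrite (toggle_setE e eL) setU11 setU1K // (toggle_setE f XL) (negPf fX) fL.
by move/setP/(_ f); rewrite setU11 (negPf fX).
Qed.

End HereditaryToggles.

Section CyclesAntichain.

Variable G : multigraph.
Implicit Types C D X Y : {set edge G}.

(** Replaces the two lists by injective families indexed by ['I_n], so that the rotation becomes the
    cyclic successor [ordS]. *)
Lemma cycle_param C : is_cycle C ->
  exists n (v : 'I_n -> vertex G) (x : 'I_n -> edge G),
    [/\ 0 < n, injective v, injective x,
        forall i, ends (x i) = [set v i; v (ordS i)] & C = [set x i | i : 'I_n]].
Proof.
case/is_cycleP=> vs [es [/and4P[es0 uvs ues /eqP h] ->]].
have sz : size vs = size es.
  by move/(congr1 size): h; rewrite !size_map size_zip size_rot minnn.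
case: es => // e0 es in es0 ues h sz *; case: vs => // v0 vs in uvs h sz *.
set s := e0 :: es in es0 ues h sz *; set t := v0 :: vs in uvs h sz *.
exists (size s), (fun i => nth v0 t i), (fun i => nth e0 s i); split=> //.
- by move=> i j /eqP; rewrite nth_uniq ?sz // => /eqP/val_inj.
- by move=> i j /eqP; rewrite nth_uniq // => /eqP/val_inj.
- move=> i; move/(congr1 (nth set0 ^~ (i : nat))): h.
  rewrite (nth_map e0) // (nth_map (v0, v0)) ?size_zip ?size_rot ?minnn ?sz //.
  rewrite nth_zip ?size_rot //= => ->; congr [set _; _].
  rewrite rot1_cons nth_rcons; case: sz => sz; rewrite sz.
  (* At the last index both the rotation and [ordS] wrap around to 0. *)
  have := ltn_ord i; rewrite /= ltnS leq_eqVlt => /orP[/eqP ->|ilt].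
    by rewrite ltnn eqxx modnn.
  by rewrite ilt modn_small.
- apply/setP=> z; rewrite !inE; apply/idP/imsetP => [zs|[i _ ->]].
    by exists (Ordinal (etrans (index_mem z s) zs)); rewrite //= nth_index.
  exact: (mem_nth e0 (ltn_ord i)).
Qed.

Lemma ordS_closed n (A : {set 'I_n}) i :
  (forall j, j \in A -> ordS j \in A) -> i \in A -> A = [set: 'I_n].
Proof.
move=> h iA.
have it k : iter k (@ordS n) i \in A by elim: k => //= k; apply: h.
have val_it k : iter k (@ordS n) i = (i + k) %% n :> nat.
  elim: k => [|k IH]; first by rewrite addn0 modn_small.
  by rewrite iterS /= IH -addn1 modnDml addn1 addnS.
apply/setP=> j; rewrite inE.
(* Going from [i] up to [n], which is 0 modulo [n], and then [j] further steps reaches [j]. *)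
suff <- : iter (n - i + j) (@ordS n) i = j by exact: it.
apply: ord_inj; rewrite val_it addnA subnKC; last exact: ltnW.
by rewrite modnDl modn_small.
Qed.

Lemma cycle_antichain C D : is_cycle C -> is_cycle D -> C \subset D -> C = D.
Proof.
move=> /cycle_param[n [v [x [n0 vI xI endx eC]]]].
move=> /cycle_param[m [w [y [_ wI _ endy eD]]]] CD.
have memC j : x j \in C by rewrite eC imset_f.
have xD j : exists p, x j = y p.
  by have := subsetP CD _ (memC j); rewrite eD => /imsetP[p _ ->]; exists p.
have [i0 xi0] := xD (Ordinal n0).
have closed i : y i \in C -> y (ordS i) \in C.
  move=> yiC; have [j _ yx] : exists2 j, j \in 'I_n & y i = x j.
    by apply/imsetP; rewrite -eC.
  (* [l] is the neighbour of [j] along [C] at the vertex [w (ordS i)]. It equals [j] only when [C]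
     is a loop, and then [x j] has a single end. *)
  have [l lv lj] : exists2 l, w (ordS i) \in ends (x l)
                     & l = j -> ends (x j) = [set w (ordS i)].
    have: w (ordS i) \in ends (x j) by rewrite -yx endy !inE eqxx orbT.
    rewrite endx !inE => /orP[]/eqP wv.
      exists (ord_pred j); first by rewrite endx ord_predK wv !inE eqxx orbT.
      by move=> pj; rewrite -{2}pj ord_predK setUid wv.
    exists (ordS j); first by rewrite endx wv !inE eqxx.
    by move=> sj; rewrite wv sj setUid.
  have [p xy] := xD l; move: lv; rewrite xy endy !inE => /orP[/eqP/wI->|].
    by rewrite -xy.
  (* Here [x l] is [y i] itself, so [l = j] and [y i] is a loop; its ends coincide, which forces
     [ordS i = i]. *)
  move=> /eqP/wI/(can_inj (@ordSK m)) ip; move: xy; rewrite -ip yx => /xI/lj.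
  rewrite -yx endy => /setP/(_ (w i)); rewrite !inE eqxx /=.
  by move/esym/eqP/wI <-.
have all_y : [set i | y i \in C] = [set: 'I_m].
  by apply: (@ordS_closed _ _ i0) => [j|]; rewrite !inE -?xi0 //; exact: closed.
apply/eqP; rewrite eqEsubset CD eD; apply/subsetP=> _ /imsetP[i _ ->].
by move/setP/(_ i): all_y; rewrite !inE.
Qed.

Lemma acyclic_sub X Y : X \subset Y ->
  Y \in acyclic_subgraphs G -> X \in acyclic_subgraphs G.
Proof.
rewrite !inE => XY /forallP aY; apply/forallP=> C; apply/implyP=> cC.
by apply: contra (implyP (aY C) cC) => CX; exact: subset_trans XY.
Qed.

Lemma cycle_proper_acyclic C X : is_cycle C -> X \proper C ->
  X \in acyclic_subgraphs G.
Proof.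
move=> cC XC; rewrite inE; apply/forallP=> D; apply/implyP=> cD.
apply/negP=> DX; have DC := subset_trans DX (proper_sub XC).
by move: XC; rewrite -(cycle_antichain cD cC DC) properE DX andbF.
Qed.

End CyclesAntichain.

Unset Implicit Arguments.

Theorem lemma3p29 (G : multigraph) (e f : edge G) (hef : e != f) :
  (toggle (acyclic_subgraphs G) e * toggle (acyclic_subgraphs G) f) ^+ 2 = 1
  <-> ~ (exists C : {set edge G}, is_cycle C /\ e \in C /\ f \in C).
Proof.
apply: (iff_trans (sqr_toggleM_eq1 (@acyclic_sub G) hef)); split.
  move=> h [C [cC [eC fC]]].
  have CefC : C :\ e :\ f = C :\ f :\ e by rewrite setDDl setUC -setDDl.
  (* Exchange will be applied at [C :\ e :\ f]: adding back one edge gives a proper subset of [C],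
     adding back both gives [C]. *)
  have CE : e |: (f |: (C :\ e :\ f)) = C.
    by rewrite setD1K ?setD1K // !inE eq_sym hef fC.
  have aC : C \in acyclic_subgraphs G.
    rewrite -CE; apply: h; rewrite ?in_setD1 ?eqxx ?andbF //.
      apply: (cycle_proper_acyclic cC); rewrite CefC setD1K.
        exact: properD1.
      by rewrite !inE hef.
    apply: (cycle_proper_acyclic cC); rewrite setD1K; first exact: properD1.
    by rewrite !inE eq_sym hef.
  by move: aC; rewrite inE => /forallP/(_ C); rewrite cC subxx.
move=> noC X eX fX; rewrite !inE => /forallP aeX /forallP afX.
apply/forallP=> C; apply/implyP=> cC; apply/negP=> /subsetP CX.
(* A cycle in [X + e + f] misses [e] or [f], so it already lies in [X + f] or [X + e]. *)
have [eC|eC] := boolP (e \in C).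
  have [fC|fC] := boolP (f \in C); first by case: noC; exists C.
  move/implyP: (aeX C) => /(_ cC)/negP; apply; apply/subsetP=> z zC.
  by move: (CX z zC); rewrite !inE; case: (eqVneq z f) zC fC => // -> ->.
move/implyP: (afX C) => /(_ cC)/negP; apply; apply/subsetP=> z zC.
by move: (CX z zC); rewrite !inE; case: (eqVneq z e) zC eC => // -> ->.
Qed.
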